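(* Let $p$ be a prime and let $a,b$ be integers with $0\leq a,b\leq p-1$ such that $p\nmid b$ and $p\nmid a-b$. Then there are infinitely many positive integers $n$ for which every $(a,b)$-town$\pmod p$ family $\mathcal{F}\subseteq\mathscr{P}(n)$ satisfies $|\mathcal{F}|\leq n-1$.
   Context: $[n]=\{1,2,\ldots,n\}$ and $\mathscr{P}(n)$ is the power set of $[n]$; a family $\mathcal{F}\subseteq\mathscr{P}(n)$ is a set of (distinct) subsets of $[n]$. For integers $k\ge 2$ and $0\le a,b\le k-1$, a family $\mathcal{F}\subseteq\mathscr{P}(n)$ is an $(a,b)$-town$\pmod k$ if for any distinct $A,B\in\mathcal{F}$ we have $|A|\equiv a\pmod k$ and $|A\cap B|\equiv b\pmod k$; that is, every set in $\mathcal{F}$ has cardinality $\equiv a\pmod k$ and every intersection of two distinct sets of $\mathcal{F}$ has cardinality $\equiv b\pmod k$. *)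

(* Defs.v *)
From mathcomp Require Import all_boot all_order all_algebra.

Set Implicit Arguments.
Unset Strict Implicit.
Unset Printing Implicit Defensive.

(* The ground set [n] = {1, ..., n} is represented by 'I_n = {0, ..., n-1}.
   The size condition is imposed on every member of F, including the sole
   member of a one-element family. *)
Definition is_town (n k a b : nat) (F : {set {set 'I_n}}) : Prop :=
  (forall A : {set 'I_n}, A \in F -> #|A| = a %[mod k]) /\
  (forall A B : {set 'I_n}, A \in F -> B \in F -> A <> B ->
     #|A :&: B| = b %[mod k]).

(* Main.v *)
(* Suppose a town on [n] has n members, with characteristic vectors v_i over
   F_p, and let u be the all-ones vector. All inner products among v_1, ..., v_n, u
   are known, and the congruence class of n mod p can be chosen so that they
   force these n + 1 vectors of F_p^n to be linearly independent, which is
   absurd. When a = 0 the class n = 0 works: the v_i are then independent and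
   orthogonal to u. When a <> 0, it suffices that both n and a - b + n b - a^2
   are nonzero mod p; since then p > 2, one of n = 1 and n = 2 qualifies. *)
Require Import Defs.
From mathcomp Require Import all_boot all_order all_algebra.
From mathcomp Require Import zify ring.

Set Implicit Arguments.
Unset Strict Implicit.
Unset Printing Implicit Defensive.

Import GRing.Theory.

Section TownMatrix.
Local Open Scope ring_scope.
Variables (K : fieldType) (n : nat) (a b : K) (M : 'M[K]_n).
Hypotheses (n_gt0 : (0 < n)%N) (neq_ab : a - b != 0).
(** The Gram determinant of the rows of [M] together with u is (a - b)^(n-1) n (a - b + n b - a^2),
    nonzero in the first case. In the second case it vanishes, since u is then orthogonal to every
    row and to itself. *)
Hypothesis class_n :
  (n%:R != 0 :> K) && (a - b + n%:R * b - a ^+ 2 != 0)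
  || (a == 0) && (n%:R == 0 :> K).
Hypothesis gramM : forall i j, \sum_k M i k * M j k = (if i == j then a else b).
Hypothesis sumM : forall i, \sum_k M i k = a.

(** Pairing the relation with u and with each row, then summing the latter equations, gives two
    linear equations in t and the sum s of the [y i]. Once s and t a vanish, each row equation
    reduces to (a - b) y_j = 0. *)
Lemma town_rows_independent (y : 'I_n -> K) (t : K) :
  (forall k, \sum_i y i * M i k + t = 0) -> (forall i, y i = 0) /\ t = 0.
Proof.
move=> dep; set s := \sum_i y i.
have eq_u : s * a + n%:R * t = 0.
  have : \sum_k (\sum_i y i * M i k + t) = 0 by apply: big1 => k _; apply: dep.
  rewrite big_split /= exchange_big /= sumr_const card_ord mulr_natl => <-.
  congr (_ + _); rewrite /s mulr_suml; apply: eq_bigr => i _.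
  by rewrite -mulr_sumr sumM.
have eq_v j : (a - b) * y j + b * s + t * a = 0.
  have : \sum_k (\sum_i y i * M i k + t) * M j k = 0.
    by apply: big1 => k _; rewrite dep mul0r.
  under eq_bigr do rewrite mulrDl mulr_suml.
  rewrite big_split /= exchange_big /= -mulr_sumr sumM => <-; congr (_ + _).
  under [RHS]eq_bigr => i _.
    under eq_bigr do rewrite -mulrA.
    rewrite -mulr_sumr gramM; over.
  rewrite /s (bigD1 j) //= [RHS](bigD1 j) //= eqxx.
  rewrite mulrDr addrA -mulrDl; congr (_ + _); first by ring.
  rewrite mulr_sumr; apply: eq_bigr => i /negPf neq_ij.
  by rewrite neq_ij mulrC.
have eq_s : (a - b + n%:R * b) * s + n%:R * t * a = 0.
  have : \sum_j ((a - b) * y j + b * s + t * a) = 0 by apply: big1.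
  rewrite !big_split /= -mulr_sumr !sumr_const card_ord -/s => <-; ring.
have s0 : s = 0.
  case/orP: class_n => /andP[].
    (* By [eq_u], n t = - s a; substituted in [eq_s], this leaves (a - b + n b - a^2) s = 0. *)
    move=> _ nz; apply/eqP; rewrite -(mulrI_eq0 s (mulfI nz)); apply/eqP.
    by rewrite -[RHS]eq_s; move/eqP: eq_u; rewrite addrC addr_eq0 => /eqP->; ring.
  move=> _ /eqP n0; apply/eqP; rewrite -(mulrI_eq0 s (mulfI neq_ab)).
  by rewrite -eq_s n0; apply/eqP; ring.
have ta0 : t * a = 0.
  case/orP: class_n => /andP[]; last by move=> /eqP->; rewrite mulr0.
  move=> nz _; move: eq_u; rewrite s0 mul0r add0r => /eqP.
  by rewrite mulf_eq0 (negPf nz) => /eqP->; rewrite mul0r.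
have y0 i : y i = 0.
  move/eqP: (eq_v i); rewrite s0 ta0 mulr0 !addr0 mulf_eq0 (negPf neq_ab).
  by move/eqP.
(* When a = n = 0 in [K] no pairing determines t, so it is read off from a single coordinate of the
   relation. *)
split=> //; rewrite -(dep (Ordinal n_gt0)) big1 ?add0r // => i _.
by rewrite y0 mul0r.
Qed.

Lemma town_matrix_absurd : False.
Proof.
pose N : 'M[K]_(n + 1, n) := col_mx M (const_mx 1).
have /rowV0Pn[x /sub_kermxP xN x_neq0] : kermx N != 0.
  rewrite kermx_eq0 /row_free; apply/eqP=> rkN.
  by have := rank_leq_col N; rewrite rkN addn1 ltnn.
have [|y0 t0] := @town_rows_independent (lsubmx x 0) (rsubmx x 0 0).
  move=> k; move/matrixP: xN => /(_ 0 k).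
  rewrite -{1}[x]hsubmxK mul_row_col !mxE big_ord1 !mxE mulr1 => E.
  by rewrite -[RHS]E; congr (_ + _); apply: eq_bigr => i _; rewrite !mxE.
case/eqP: x_neq0; rewrite -[x]hsubmxK -[RHS]row_mx0; congr row_mx.
  by apply/rowP=> i; rewrite y0 mxE.
by apply/rowP=> i; rewrite ord1 t0 mxE.
Qed.

End TownMatrix.

Lemma eqmod_natr_Fp (p : nat) (hp : prime p) (x y : nat) :
  (x%:R == y%:R :> 'F_p)%R = (x == y %[mod p]).
Proof. by rewrite -(inj_eq val_inj) /= !val_Fp_nat. Qed.

Lemma town_card_lt (p n a b : nat) (F : {set {set 'I_n}}) :
    prime p -> 0 < n -> (a%:R - b%:R != 0 :> 'F_p)%R ->
    ((n%:R != 0 :> 'F_p) && (a%:R - b%:R + n%:R * b%:R - a%:R ^+ 2 != 0 :> 'F_p)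
    || (a%:R == 0 :> 'F_p) && (n%:R == 0 :> 'F_p))%R ->
  is_town p a b F -> #|F| < n.
Proof.
move=> hp n_gt0 neq_ab class_n [sizeF interF].
rewrite ltnNge; apply/negP=> le_nF.
pose v (i : 'I_n) : {set 'I_n} := enum_val (widen_ord le_nF i).
have vF i : v i \in F by apply: enum_valP.
have v_inj : injective v.
  by move=> i j /enum_val_inj/(congr1 val) /= /val_inj.
pose M : 'M['F_p]_n := (\matrix_(i, k) (k \in v i)%:R)%R.
apply: (@town_matrix_absurd _ n a%:R%R b%:R%R M n_gt0 neq_ab class_n).
(* Inner products of characteristic vectors count intersections. *)
- move=> i j; transitivity (#|v i :&: v j|%:R : 'F_p)%R.
    rewrite -sum1_card natr_sum [RHS]big_mkcond; apply: eq_bigr => k _.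
    by rewrite !mxE -natrM mulnb inE; case: ifP.
  apply/eqP; have [-> | /eqP neq_ij] := eqVneq i j; rewrite eqmod_natr_Fp //.
    by rewrite setIid; apply/eqP/sizeF.
  by apply/eqP/interF => // /v_inj.
- move=> i; transitivity (#|v i|%:R : 'F_p)%R.
    rewrite -sum1_card natr_sum [RHS]big_mkcond; apply: eq_bigr => k _.
    by rewrite !mxE; case: ifP.
  by apply/eqP; rewrite eqmod_natr_Fp //; apply/eqP/sizeF.
Qed.

Theorem theorem1p5 (p : nat) (hp : prime p) (a b : nat)
    (ha : a <= p - 1) (hb : b <= p - 1)
    (hpb : ~~ (p %| b))
    (hpab : ~~ (Posz p %| (Posz a - Posz b)%R)%Z) :
  forall N : nat, exists n : nat,
    N < n /\
    forall F : {set {set 'I_n}}, is_town p a b F -> #|F| <= n - 1.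
Proof.
move=> N; have p_gt1 := prime_gt1 hp.
have neq_ab : a <> b by move=> eq_ab; move: hpab; rewrite eq_ab subrr dvdz0.
have b_gt0 : 0 < b by case: (b) hpb; rewrite ?dvdn0.
have abF : (a%:R - b%:R != 0 :> 'F_p)%R.
  by rewrite subr_eq0 eqmod_natr_Fp // !modn_small; [apply/eqP | lia | lia].
have lt_sub n m : m < n -> m <= n - 1 by lia.
(* Adding [p * N.+1] moves any residue, 0 included, beyond [N] without changing its class. *)
have pF k : ((k + p * N.+1)%:R = k%:R :> 'F_p)%R.
  by apply/eqP; rewrite eqmod_natr_Fp // addnC mulnC modnMDl.
have gtN k : N < k + p * N.+1 by nia.
have [a0 | a_neq0] := eqVneq a 0.
  exists (0 + p * N.+1); split=> // F townF; apply: lt_sub.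
  apply: (town_card_lt hp _ abF _ townF); first exact: leq_ltn_trans (gtN 0).
  by rewrite pF a0 eqxx orbT.
have smallF k : 0 < k < p -> (k%:R != 0 :> 'F_p)%R.
  move=> ltkp; rewrite -[0%R]/(0%:R)%R eqmod_natr_Fp // !modn_small; lia.
have [r [r_neq0 r_good]] : exists r,
    (r%:R != 0 :> 'F_p)%R
    /\ (a%:R - b%:R + r%:R * b%:R - a%:R ^+ 2 != 0 :> 'F_p)%R.
  (* From r = 1 to r = 2 the expression grows by b, which is nonzero mod p, so it cannot vanish at
     both. Here 2 < p because a and b are distinct and lie strictly between 0 and p. *)
  have [e1|] := eqVneq (a%:R - b%:R + 1%:R * b%:R - a%:R ^+ 2 : 'F_p)%R 0%R.
    exists 2; split; first by apply: smallF; lia.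
    rewrite (_ : _ - _ = a%:R - b%:R + 1%:R * b%:R - a%:R ^+ 2 + b%:R)%R.
      by rewrite e1 add0r; apply: smallF; lia.
    by ring.
  by exists 1; split=> //; apply: smallF; lia.
exists (r + p * N.+1); split=> // F townF; apply: lt_sub.
apply: (town_card_lt hp _ abF _ townF); first exact: leq_ltn_trans (gtN r).
by rewrite pF r_neq0 r_good.
Qed.
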